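(* Let $G$ be a finite group and $\omega$ a normalized $3$-cocycle on $G$ with values in $\Bbbk^\times$. Let $K,L\le G$ be subgroups on which the class of the restriction of $\omega$ is trivial, and let $\beta\in C^2(K,\Bbbk^\times)$, $\psi\in C^2(L,\Bbbk^\times)$ be normalized $2$-cochains with $d\beta=\omega|_{K^{\times3}}$, $d\psi=\omega|_{L^{\times3}}$. For the twisted Hecke algebra $A^{K,\beta}(L,\psi)$ it holds that $$\dim_\Bbbk\mathrm{Hom}_{\mathcal C(G,\omega,K,\beta)}\big(A(K,\beta),A^{K,\beta}(L,\psi)\big)=|K\cap L|.$$ As a consequence, $A^{K,\beta}(L,\psi)$ is connected precisely when $|K\cap L|=1$.
   Context: $\Bbbk$ is an algebraically closed field of characteristic $0$. $\mathsf{Vec}_G^\omega$: the fusion category of finite-dimensional $G$-graded $\Bbbk$-vector spaces, with simple objects $\delta_g$ ($g\in G$; also denoting a fixed basis vector in degree $g$), associativity $\alpha_{\delta_g,\delta_{g'},\delta_{g''}}=\omega^{-1}(g,g',g'')\,\mathrm{id}:(\delta_g\otimes\delta_{g'})\otimes\delta_{g''}\to\delta_g\otimes(\delta_{g'}\otimes\delta_{g''})$, unit $\delta_e$, $l_{\delta_g}=\omega^{-1}(e,e,g)\mathrm{id}$, $r_{\delta_g}=\omega(g,e,e)\mathrm{id}$. Cocycle condition: $\omega(g_1g_2,g_3,g_4)\omega(g_1,g_2,g_3g_4)=\omega(g_1,g_2,g_3)\omega(g_1,g_2g_3,g_4)\omega(g_2,g_3,g_4)$. For a $2$-cochain $\theta$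 on a subgroup $N$, $d\theta=\omega|_{N^{\times3}}$ means $\theta(f_1,f_2f_3)\theta(f_2,f_3)=\omega(f_1,f_2,f_3)\theta(f_1f_2,f_3)\theta(f_1,f_2)$. Twisted group algebra: $A(N,\theta)=\bigoplus_{g\in N}\delta_g$ with multiplication $\delta_g\otimes\delta_{g'}\mapsto\theta(g,g')\delta_{gg'}$ and unit $\delta_e\mapsto\delta_e$. Group-theoretical fusion category: $\mathcal C(G,\omega,K,\beta)$ is the category of $A(K,\beta)$-bimodules in $\mathsf{Vec}_G^\omega$, monoidal under $\otimes_{A(K,\beta)}$ with unit object $A(K,\beta)$. Twisted Hecke algebra: with $A=A(K,\beta)$ and $X=A(L,\psi)$, the underlying object of $A^{K,\beta}(L,\psi)$ is the free bimodule $(A\otimes X)\otimes A$ with right action $(\mathrm{id}_{A\otimes X}\otimes m_A)\alpha_{A\otimes X,A,A}$ and left action $((m_A\otimes\mathrm{id}_X)\alpha^{-1}_{A,A,X}\otimes\mathrm{id}_A)\alpha^{-1}_{A,A\otimes X,A}$. (Its algebra structure, induced from the multiplication of $A(L,\psi)$, plays no role in the statement.) An algebra $B$ in a fusion category with unit object $\mathbf 1$ is connected if $\dim_\Bbbk\mathrm{Hom}(\mathbf 1,B)=1$; here $\mathbf 1=A(K,\beta)$. *)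

(* Defs.v *)
From HB Require Import structures.
From mathcomp Require Import all_boot all_order all_algebra all_fingroup.
From mathcomp Require Import ring.

Set Implicit Arguments.
Unset Strict Implicit.
Unset Printing Implicit Defensive.

Import GRing.Theory.
Local Open Scope ring_scope.

Reserved Notation "u \ox v" (at level 40, left associativity).
Reserved Notation "f \otimes g" (at level 40, left associativity).
Reserved Notation "U \OX V" (at level 40, left associativity).

Definition bilin (k : fieldType) (U V W : vectType k) (b : U -> V -> W) :=
  (forall v, linear (b^~ v)) /\ (forall u, linear (b u)).

(* U (x) V is realised as Hom(U^*, V); u (x) v is the map phi |-> phi(u) v.  *)
Definition tens (k : fieldType) (U V : vectType k) : vectType k :=
  'Hom('Hom(U, k^o), V).

Section Tensor.
Variable k : fieldType.
Implicit Types U V W : vectType k.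

Definition tpure U V (u : U) (v : V) : tens U V :=
  linfun (fun phi : 'Hom(U, k^o) => (phi u : k) *: v).
Local Notation "u \ox v" := (tpure u v).

Lemma tpureE U V (u : U) (v : V) (phi : 'Hom(U, k^o)) :
  (u \ox v : 'Hom('Hom(U, k^o), V)) phi = (phi u : k) *: v.
Proof.
pose f (p : 'Hom(U, k^o)) := (p u : k) *: v.
have fP : linear f.
  by move=> a p q; rewrite /f add_lfunE scale_lfunE scalerDl scalerA.
pose F := GRing.isLinear.Build k 'Hom(U, k^o) V _ f fP.
pose L : {linear 'Hom(U, k^o) -> V} := HB.pack f F.
exact: (lfunE L phi).
Qed.

Lemma tpure_bilin U V : bilin (@tpure U V).
Proof.
split=> [v a x y | u a x y]; apply/lfunP=> phi.
  by rewrite add_lfunE scale_lfunE !tpureE linearP scalerDl scalerA.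
rewrite add_lfunE scale_lfunE !tpureE scalerDr !scalerA.
by rewrite mulrC.
Qed.

Definition dual_basis U (i : 'I_(\dim {:U})) : 'Hom(U, k^o) :=
  linfun (fun u : U => coord (vbasis {:U}) i u : k^o).

Lemma dual_basisE U i (u : U) :
  dual_basis i u = coord (vbasis {:U}) i u.
Proof.
pose f (u : U) : k^o := coord (vbasis {:U}) i u.
have fP : linear f by move=> a p q; rewrite /f linearP.
pose F := GRing.isLinear.Build k U k^o _ f fP.
pose L : {linear U -> k^o} := HB.pack f F.
exact: (lfunE L u).
Qed.

(* The linear map on U (x) V induced by b, meaningful when b is bilinear:   *)
(* see tliftE below.                                                        *)
Definition tlift U V W (b : U -> V -> W) : 'Hom(tens U V, W) :=
  linfun (fun T : 'Hom('Hom(U, k^o), V) =>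
            \sum_(i < \dim {:U}) b (vbasis {:U})`_i (T (dual_basis i))).

Lemma bilin_suml U V W (b : U -> V -> W) I (r : seq I) P F v : bilin b ->
  b (\sum_(i <- r | P i) F i) v = \sum_(i <- r | P i) b (F i) v.
Proof.
case=> bl _; have b0 : b 0 v = 0.
  by have := bl v (-1) 0 0; rewrite /= scaler0 addr0 scaleN1r addNr.
apply: (big_morph (b^~ v)) => //= x y.
by have := bl v 1 x y; rewrite /= !scale1r.
Qed.

Lemma bilin_sumr U V W (b : U -> V -> W) I (r : seq I) P F u : bilin b ->
  b u (\sum_(i <- r | P i) F i) = \sum_(i <- r | P i) b u (F i).
Proof.
case=> _ br; have b0 : b u 0 = 0.
  by have := br u (-1) 0 0; rewrite /= scaler0 addr0 scaleN1r addNr.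
apply: (big_morph (b u)) => //= x y.
by have := br u 1 x y; rewrite /= !scale1r.
Qed.

Lemma bilinZl U V W (b : U -> V -> W) a u v : bilin b ->
  b (a *: u) v = a *: b u v.
Proof.
move=> bb; have b0 : b 0 v = 0.
  by have := @bilin_suml _ _ _ b nat [::] xpredT (fun=> 0) v bb; rewrite !big_nil.
by have := bb.1 v a u 0; rewrite /= b0 !addr0.
Qed.

Lemma bilinZr U V W (b : U -> V -> W) a u v : bilin b ->
  b u (a *: v) = a *: b u v.
Proof.
move=> bb; have b0 : b u 0 = 0.
  by have := @bilin_sumr _ _ _ b nat [::] xpredT (fun=> 0) u bb; rewrite !big_nil.
by have := bb.2 u a v 0; rewrite /= b0 !addr0.
Qed.

Lemma tliftE U V W (b : U -> V -> W) u v : bilin b ->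
  tlift b (u \ox v) = b u v.
Proof.
move=> bb.
pose f (T : tens U V) := \sum_(i < \dim {:U}) b (vbasis {:U})`_i
  ((T : 'Hom('Hom(U, k^o), V)) (dual_basis i)).
have fP : linear f.
  move=> a p q; rewrite /f scaler_sumr -big_split /=; apply: eq_bigr => i _.
  by rewrite add_lfunE scale_lfunE bb.2.
pose F := GRing.isLinear.Build k (tens U V) W _ f fP.
pose L : {linear tens U V -> W} := HB.pack f F.
have -> : tlift b (u \ox v) = f (u \ox v) by exact: (lfunE L).
rewrite {2}(coord_vbasis (memvf u)) bilin_suml // /f; apply: eq_bigr => i _.
by rewrite tpureE dual_basisE bilinZr // bilinZl.
Qed.

Lemma tens_decomp U V (T : tens U V) :
  T = \sum_(i < \dim {:U})
        (vbasis {:U})`_i \ox (T : 'Hom('Hom(U, k^o), V)) (dual_basis i).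
Proof.
apply/lfunP=> phi; rewrite sum_lfunE.
have {1}-> : phi =
    \sum_(i < \dim {:U}) (phi (vbasis {:U})`_i : k) *: dual_basis i.
  apply/lfunP=> u; rewrite sum_lfunE {1}(coord_vbasis (memvf u)) linear_sum.
  apply: eq_bigr => i _; rewrite linearZ /= scale_lfunE dual_basisE.
  exact: mulrC.
rewrite linear_sum; under eq_bigr do rewrite linearZ /=.
by apply: eq_bigr => i _; rewrite tpureE.
Qed.

Lemma tens_ind U V (P : tens U V -> Prop) :
    P 0 -> (forall s t, P s -> P t -> P (s + t)) ->
    (forall u v, P (u \ox v)) ->
  forall t, P t.
Proof. by move=> P0 PD Pp t; rewrite (tens_decomp t); apply: big_ind. Qed.

Lemma tpureDl U V (u u' : U) (v : V) : (u + u') \ox v = u \ox v + u' \ox v.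
Proof. by have := (tpure_bilin U V).1 v 1 u u'; rewrite /= !scale1r. Qed.
Lemma tpureDr U V (u : U) (v v' : V) : u \ox (v + v') = u \ox v + u \ox v'.
Proof. by have := (tpure_bilin U V).2 u 1 v v'; rewrite /= !scale1r. Qed.
Lemma tpureZl U V a (u : U) (v : V) : (a *: u) \ox v = a *: (u \ox v).
Proof. exact: bilinZl (tpure_bilin U V). Qed.
Lemma tpureZr U V a (u : U) (v : V) : u \ox (a *: v) = a *: (u \ox v).
Proof. exact: bilinZr (tpure_bilin U V). Qed.
Lemma tpure0l U V (v : V) : (0 : U) \ox v = 0.
Proof. by rewrite -(scale0r (0 : U)) tpureZl scale0r. Qed.
Lemma tpure0r U V (u : U) : u \ox (0 : V) = 0.
Proof. by rewrite -(scale0r (0 : V)) tpureZr scale0r. Qed.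
Lemma tpure_suml U V I (r : seq I) P F (v : V) :
  (\sum_(i <- r | P i) F i : U) \ox v = \sum_(i <- r | P i) F i \ox v.
Proof. exact: bilin_suml (tpure_bilin U V). Qed.
Lemma tpure_sumr U V I (r : seq I) P F (u : U) :
  u \ox (\sum_(i <- r | P i) F i : V) = \sum_(i <- r | P i) u \ox F i.
Proof. exact: bilin_sumr (tpure_bilin U V). Qed.

Definition tmap U U' V V' (f : 'Hom(U, U')) (g : 'Hom(V, V')) :
    'Hom(tens U V, tens U' V') :=
  tlift (fun u v => f u \ox g v).

Lemma tmapE U U' V V' (f : 'Hom(U, U')) (g : 'Hom(V, V')) u v :
  tmap f g (u \ox v) = f u \ox g v.
Proof.
rewrite /tmap tliftE //; split=> [w a x y | w a x y] /=.
  by rewrite linearP /= tpureDl tpureZl.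
by rewrite linearP /= tpureDr tpureZr.
Qed.

End Tensor.

Notation "u \ox v" := (tpure u v) : ring_scope.
Notation "f \otimes g" := (tmap f g) : ring_scope.

Record cocycle3 (k : fieldType) (G : finGroupType) := Cocycle3 {
  coc3 :> G -> G -> G -> k;
  coc3_neq0 : forall g1 g2 g3, coc3 g1 g2 g3 != 0;
  coc3P : forall g1 g2 g3 g4,
    coc3 (g1 * g2)%g g3 g4 * coc3 g1 g2 (g3 * g4)%g
    = coc3 g1 g2 g3 * coc3 g1 (g2 * g3)%g g4 * coc3 g2 g3 g4;
  coc3_norm : forall g h,
    [/\ coc3 1%g g h = 1, coc3 g 1%g h = 1 & coc3 g h 1%g = 1]
}.

Record cochain2 (k : fieldType) (N : finGroupType) := Cochain2 {
  coch2 :> N -> N -> k;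
  coch2_neq0 : forall f1 f2, coch2 f1 f2 != 0;
  coch2_norm : forall f, coch2 1%g f = 1 /\ coch2 f 1%g = 1
}.

(* d theta = omega restricted to N, in the multiplicative convention that   *)
(* makes A(N, theta) below associative.                                     *)
Definition cobounds (k : fieldType) (G : finGroupType) (omega : cocycle3 k G)
    (N : {group G}) (theta : cochain2 k (subg_of N)) :=
  forall f1 f2 f3 : subg_of N,
    theta f1 (f2 * f3)%g * theta f2 f3
    = omega (sgval f1) (sgval f2) (sgval f3)
      * theta (f1 * f2)%g f3 * theta f1 f2.

(* A grading V = \bigoplus_g V_g is given by its projections V -> V_g.      *)
Record gvect (k : fieldType) (G : finGroupType) := GVect {
  gcar :> vectType k;
  gproj : G -> 'End(gcar);
  gproj_orth : forall g h v,
    gproj g (gproj h v) = if g == h then gproj h v else 0;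
  gproj_sum : forall v, \sum_g gproj g v = v
}.
Arguments gproj {k G} _ _.

Section GradedSpaces.
Variables (k : fieldType) (G : finGroupType).
Implicit Types U V W : gvect k G.

Definition homog V (g : G) (v : V) := gproj V g v = v.

Definition graded U V (f : 'Hom(U, V)) :=
  forall g u, f (gproj U g u) = gproj V g (f u).

Lemma homog_gproj V g (v : V) : homog g (gproj V g v).
Proof. by rewrite /homog gproj_orth eqxx. Qed.

Lemma gproj_homog V g h (v : V) : homog h v ->
  gproj V g v = if g == h then v else 0.
Proof. by move=> hv; rewrite -{1}hv gproj_orth hv. Qed.

Lemma graded_homog U V (f : 'Hom(U, V)) g u :
  graded f -> homog g u -> homog g (f u).
Proof. by move=> gf hu; rewrite /homog -gf hu. Qed.

Lemma homogZ V g a (v : V) : homog g v -> homog g (a *: v).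
Proof. by rewrite /homog linearZ /= => ->. Qed.

Definition gtens_proj U V (g : G) : 'End(tens U V) :=
  \sum_(p : G * G | (p.1 * p.2)%g == g) gproj U p.1 \otimes gproj V p.2.

Lemma gtens_projE U V g (u : U) (v : V) : gtens_proj U V g (u \ox v) =
  \sum_(p : G * G | (p.1 * p.2)%g == g) gproj U p.1 u \ox gproj V p.2 v.
Proof. by rewrite sum_lfunE; apply: eq_bigr => p _; rewrite tmapE. Qed.

Lemma gtens_proj_homog U V g h1 h2 (u : U) (v : V) :
  homog h1 u -> homog h2 v ->
  gtens_proj U V g (u \ox v) = if g == (h1 * h2)%g then u \ox v else 0.
Proof.
move=> hu hv; rewrite gtens_projE.
have E p : gproj U p.1 u \ox gproj V p.2 v =
    if p == (h1, h2) then u \ox v else 0.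
  rewrite (gproj_homog _ hu) (gproj_homog _ hv) -pair_eqE /=.
  by do 2!case: ifP => _ //=; rewrite ?tpure0l ?tpure0r.
under eq_bigr do rewrite E; rewrite -big_mkcondr /=.
case: eqP => [-> | ne]; last first.
  by rewrite big1 // => p /andP[/eqP def_g /eqP def_p]; case: ne; rewrite -def_g def_p.
rewrite (big_pred1 (h1, h2)) // => p /=.
by case: (p =P (h1, h2)) => [-> | _]; rewrite ?eqxx ?andbF.
Qed.

Lemma gdecomp V (v : V) : v = \sum_g gproj V g v.
Proof. by rewrite gproj_sum. Qed.

Lemma tens_homog_ind U V (P : tens U V -> Prop) :
    P 0 -> (forall s t, P s -> P t -> P (s + t)) ->
    (forall g h u v, homog g u -> homog h v -> P (u \ox v)) ->
  forall t, P t.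
Proof.
move=> P0 PD Pp; apply: tens_ind => // u v.
rewrite (gdecomp u) tpure_suml; apply: big_ind => // g _.
rewrite (gdecomp v) tpure_sumr; apply: big_ind => // h _.
exact: (Pp g h _ _ (homog_gproj g u) (homog_gproj h v)).
Qed.

Lemma gtens_orth U V g h t : gtens_proj U V g (gtens_proj U V h t)
  = if g == h then gtens_proj U V h t else 0.
Proof.
move: t; apply: tens_homog_ind => [|s t Hs Ht|h1 h2 u v hu hv].
- by rewrite !linear0 if_same.
- by rewrite !linearD /= Hs Ht; case: ifP => _; rewrite ?addr0.
rewrite !(gtens_proj_homog _ hu hv).
case: (h =P (h1 * h2)%g) => [-> | _]; last by rewrite linear0 if_same.
exact: gtens_proj_homog.
Qed.

Lemma gtens_sum U V t : \sum_g gtens_proj U V g t = t.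
Proof.
move: t; apply: tens_homog_ind => [|s t Hs Ht|h1 h2 u v hu hv].
- by rewrite big1 // => g _; rewrite linear0.
- by under eq_bigr do rewrite linearD /=; rewrite big_split /= Hs Ht.
under eq_bigr do rewrite (gtens_proj_homog _ hu hv).
by rewrite -big_mkcond /= (big_pred1 (h1 * h2)%g).
Qed.

Definition gtens U V : gvect k G :=
  GVect (@gtens_orth U V) (@gtens_sum U V).
Local Notation "U \OX V" := (gtens U V).

Lemma homog_tpure U V g h (u : U) (v : V) :
  homog g u -> homog h v -> @homog (U \OX V) (g * h)%g (u \ox v).
Proof. by move=> hu hv; rewrite /homog /= (gtens_proj_homog _ hu hv) eqxx. Qed.

(* The graded space with basis delta_i, i : I, where delta_i has degree d i. *)
Section GFree.
Variables (I : finType) (d : I -> G).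

Definition gdelta (i : I) : {ffun I -> k^o} := [ffun j => (j == i)%:R].

Definition gfree_proj (g : G) : 'End({ffun I -> k^o}) :=
  linfun (fun v : {ffun I -> k^o} => \sum_(i | d i == g) (v i : k) *: gdelta i).

Lemma gfree_projE g v i : gfree_proj g v i = if d i == g then v i else 0.
Proof.
pose f (v : {ffun I -> k^o}) := \sum_(i | d i == g) (v i : k) *: gdelta i.
have fP : linear f.
  move=> a x y; rewrite /f scaler_sumr -big_split /=; apply: eq_bigr => j _.
  by rewrite !ffunE scalerDl scalerA.
pose F := GRing.isLinear.Build k {ffun I -> k^o} {ffun I -> k^o} _ f fP.
pose L : {linear {ffun I -> k^o} -> {ffun I -> k^o}} := HB.pack f F.
have -> : gfree_proj g v = f v by exact: (lfunE L).
rewrite /f sum_ffunE.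
have E j : ((v j : k) *: gdelta j) i = if j == i then v i else 0.
  rewrite !ffunE (eq_sym i).
  by case: (j =P i) => [-> | _]; [apply: mulr1 | apply: mulr0].
under eq_bigr do rewrite E; rewrite -big_mkcondr /=.
case: ifP => di; last first.
  by rewrite big1 // => j /andP[dj /eqP ji]; rewrite ji di in dj.
rewrite (big_pred1 i) // => j /=.
by case: (j =P i) => [->|]; rewrite ?di ?andbF.
Qed.

Lemma gfree_orth g h v : gfree_proj g (gfree_proj h v)
  = if g == h then gfree_proj h v else 0.
Proof.
apply/ffunP=> i; rewrite gfree_projE; case: (g =P h) => [<- | ne].
  by rewrite !gfree_projE; case: (d i == g).
rewrite !gfree_projE ffunE; case: (d i =P g) => // dg; case: (d i =P h) => // dh.
by case: ne; rewrite -dg.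
Qed.

Lemma gfree_sum v : \sum_g gfree_proj g v = v.
Proof.
apply/ffunP=> i; rewrite sum_ffunE; under eq_bigr do rewrite gfree_projE.
by rewrite -big_mkcond /= (big_pred1 (d i)) // => g; rewrite eq_sym.
Qed.

Definition gfree : gvect k G := GVect gfree_orth gfree_sum.

Lemma homog_gdelta i : @homog gfree (d i) (gdelta i).
Proof.
apply/ffunP=> j; rewrite gfree_projE ffunE; case: (j =P i) => [-> | _].
  by rewrite eqxx.
by rewrite if_same.
Qed.

Lemma gfree_decomp (v : {ffun I -> k^o}) :
  v = \sum_i (v i : k) *: gdelta i.
Proof.
apply/ffunP=> i; rewrite sum_ffunE (bigD1 i) //= big1 ?addr0.
  by rewrite !ffunE eqxx; exact/esym/mulr1.
by move=> j ji; rewrite !ffunE eq_sym (negPf ji); exact: mulr0.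
Qed.

Lemma gfree_ind (P : {ffun I -> k^o} -> Prop) :
    P 0 -> (forall s t, P s -> P t -> P (s + t)) ->
    (forall a i, P (a *: gdelta i)) -> forall v, P v.
Proof. by move=> P0 PD Pd v; rewrite (gfree_decomp v); apply: big_ind. Qed.

End GFree.

(* The unit object: k, concentrated in degree e.                            *)
Definition gunit_proj (g : G) : 'End(k^o) := if g == 1%g then \1%VF else 0.

Lemma gunit_orth g h v : gunit_proj g (gunit_proj h v)
  = if g == h then gunit_proj h v else 0.
Proof.
rewrite /gunit_proj; case: (h =P 1%g) => [-> | _].
  by case: ifP => _; rewrite ?lfunE.
by rewrite !zero_lfunE linear0 if_same.
Qed.

Lemma gunit_sum v : \sum_g gunit_proj g v = v.
Proof.
rewrite (bigD1 1%g) //= big1 ?addr0 /gunit_proj ?eqxx ?lfunE // => g g1.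
by rewrite (negPf g1) zero_lfunE.
Qed.

Definition gunit : gvect k G := GVect gunit_orth gunit_sum.

Lemma homog_gunit (v : gunit) : homog 1%g v.
Proof. by rewrite /homog /= /gunit_proj eqxx lfunE. Qed.

End GradedSpaces.

Notation "U \OX V" := (gtens U V) : ring_scope.

Section VecGOmega.
Variables (k : fieldType) (G : finGroupType) (omega : cocycle3 k G).
Implicit Types U V W : gvect k G.

Definition assoc U V W : 'Hom((U \OX V) \OX W, U \OX (V \OX W)) :=
  tlift (fun x w => tlift (fun u v =>
    \sum_g1 \sum_g2 \sum_g3 (omega g1 g2 g3)^-1 *:
      (gproj U g1 u \ox (gproj V g2 v \ox gproj W g3 w))) x).

Definition assocV U V W : 'Hom(U \OX (V \OX W), (U \OX V) \OX W) :=
  tlift (fun u y => tlift (fun v w =>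
    \sum_g1 \sum_g2 \sum_g3 omega g1 g2 g3 *:
      ((gproj U g1 u \ox gproj V g2 v) \ox gproj W g3 w)) y).

Definition lunitor V : 'Hom(gunit k G \OX V, V) :=
  tlift (fun (a : k^o) v =>
    \sum_g (omega 1%g 1%g g)^-1 *: ((a : k) *: gproj V g v)).

Definition runitor V : 'Hom(V \OX gunit k G, V) :=
  tlift (fun v (a : k^o) =>
    \sum_g omega g 1%g 1%g *: ((a : k) *: gproj V g v)).

Lemma sum_homog V (W : vectType k) g (v : V) (F : G -> V -> W) :
  homog g v -> (forall h, F h 0 = 0) ->
  \sum_h F h (gproj V h v) = F g v.
Proof.
move=> hv F0; rewrite (bigD1 g) //= big1 ?addr0 => [|h hg].
  by rewrite (gproj_homog _ hv) eqxx.
by rewrite (gproj_homog _ hv) (negPf hg) F0.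
Qed.

Lemma tlift_param (U V W Z : vectType k) (c : Z -> U -> V -> W) :
  (forall z, bilin (c z)) -> (forall u v, linear (fun z => c z u v)) ->
  bilin (fun z x => tlift (c z) x).
Proof.
move=> bc lc; split=> [x a z z' | z a x y] /=; last by rewrite linearP.
move: x; apply: tens_ind => [|s t Hs Ht|u v]; first by rewrite !linear0 addr0.
  by rewrite !linearD /= Hs Ht addrACA.
by rewrite !tliftE // lc.
Qed.

Lemma assocE U V W g1 g2 g3 (u : U) (v : V) (w : W) :
  homog g1 u -> homog g2 v -> homog g3 w ->
  assoc U V W ((u \ox v) \ox w) = (omega g1 g2 g3)^-1 *: (u \ox (v \ox w)).
Proof.
move=> hu hv hw; pose c (z : W) (u : U) (v : V) : U \OX (V \OX W) :=
  \sum_g1 \sum_g2 \sum_g3 (omega g1 g2 g3)^-1 *: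
      (gproj U g1 u \ox (gproj V g2 v \ox gproj W g3 z)).
have bc z : bilin (c z).
  split=> [y a x x' | x a y y'] /=; rewrite /c scaler_sumr -big_split /=;
    apply: eq_bigr => h1 _; rewrite scaler_sumr -big_split /=;
    apply: eq_bigr => h2 _; rewrite scaler_sumr -big_split /=;
    apply: eq_bigr => h3 _; rewrite linearP /=.
    by rewrite tpureDl tpureZl scalerDr !scalerA mulrC.
  by rewrite tpureDl tpureZl tpureDr tpureZr scalerDr !scalerA mulrC.
have lc x y : linear (fun z => c z x y).
  move=> a z z' /=; rewrite /c scaler_sumr -big_split /=.
  apply: eq_bigr => h1 _; rewrite scaler_sumr -big_split /=.
  apply: eq_bigr => h2 _; rewrite scaler_sumr -big_split /=.
  apply: eq_bigr => h3 _; rewrite linearP /=.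
  by rewrite !tpureDr !tpureZr scalerDr !scalerA mulrC.
have [b1 b2] := tlift_param bc lc.
rewrite /assoc tliftE; last by split=> [x|x]; [apply: b2 | apply: b1].
rewrite tliftE; last exact: bc.
rewrite (@sum_homog U (U \OX (V \OX W)) g1 u (fun h1 x => \sum_h2 \sum_h3 _ *: (x \ox _))) //;
  last first.
  by move=> h; do 2!rewrite big1 // => ? _; rewrite tpure0l scaler0.
rewrite (@sum_homog V (U \OX (V \OX W)) g2 v (fun h2 x => \sum_h3 _ *: (_ \ox (x \ox _)))) //;
  last first.
  by move=> h; rewrite big1 // => ? _; rewrite tpure0l tpure0r scaler0.
rewrite (@sum_homog W (U \OX (V \OX W)) g3 w (fun h2 x => _ *: (_ \ox (_ \ox x)))) //.
by move=> h; rewrite !tpure0r scaler0.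
Qed.

Lemma assocVE U V W g1 g2 g3 (u : U) (v : V) (w : W) :
  homog g1 u -> homog g2 v -> homog g3 w ->
  assocV U V W (u \ox (v \ox w)) = omega g1 g2 g3 *: ((u \ox v) \ox w).
Proof.
move=> hu hv hw; pose c (z : U) (u : V) (v : W) : (U \OX V) \OX W :=
  \sum_g1 \sum_g2 \sum_g3 omega g1 g2 g3 *:
      ((gproj U g1 z \ox gproj V g2 u) \ox gproj W g3 v).
have bc z : bilin (c z).
  split=> [y a x x' | x a y y'] /=; rewrite /c scaler_sumr -big_split /=;
    apply: eq_bigr => h1 _; rewrite scaler_sumr -big_split /=;
    apply: eq_bigr => h2 _; rewrite scaler_sumr -big_split /=;
    apply: eq_bigr => h3 _; rewrite linearP /=.
    by rewrite tpureDr tpureZr tpureDl tpureZl scalerDr !scalerA mulrC.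
  by rewrite tpureDr tpureZr scalerDr !scalerA mulrC.
have lc x y : linear (fun z => c z x y).
  move=> a z z' /=; rewrite /c scaler_sumr -big_split /=.
  apply: eq_bigr => h1 _; rewrite scaler_sumr -big_split /=.
  apply: eq_bigr => h2 _; rewrite scaler_sumr -big_split /=.
  apply: eq_bigr => h3 _; rewrite linearP /=.
  by rewrite !tpureDl !tpureZl scalerDr !scalerA mulrC.
rewrite /assocV tliftE; last exact: tlift_param.
rewrite tliftE; last exact: bc.
rewrite (@sum_homog U ((U \OX V) \OX W) g1 u
  (fun h1 x => \sum_h2 \sum_h3 _ *: ((x \ox _) \ox _))) //; last first.
  by move=> h; do 2!rewrite big1 // => ? _; rewrite !tpure0l scaler0.
rewrite (@sum_homog V ((U \OX V) \OX W) g2 v (fun h2 x => \sum_h3 _ *: ((_ \ox x) \ox _))) //;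
  last first.
  by move=> h; rewrite big1 // => ? _; rewrite tpure0r tpure0l scaler0.
rewrite (@sum_homog W ((U \OX V) \OX W) g3 w (fun h2 x => _ *: (_ \ox x))) //.
by move=> h; rewrite !tpure0r scaler0.
Qed.

Lemma lunitorE V g a (v : V) : homog g v ->
  lunitor V ((a : k^o) \ox v) = (omega 1%g 1%g g)^-1 *: ((a : k) *: v).
Proof.
move=> hv; rewrite /lunitor tliftE.
  rewrite (@sum_homog V V g v (fun h x => _ *: (_ *: x))) //.
  by move=> h; rewrite !scaler0.
split=> [y b x x' | x b y y'] /=; rewrite scaler_sumr -big_split /=;
    apply: eq_bigr => h _.
  rewrite scalerDl scalerDr !scalerA; congr (_ *: _ + _).
  by rewrite -mulrA; exact: mulrCA.
rewrite linearP /= !scalerDr !scalerA; congr (_ *: _ + _).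
by rewrite mulrC mulrA.
Qed.

Lemma runitorE V g a (v : V) : homog g v ->
  runitor V (v \ox (a : k^o)) = omega g 1%g 1%g *: ((a : k) *: v).
Proof.
move=> hv; rewrite /runitor tliftE.
  rewrite (@sum_homog V V g v (fun h x => _ *: (_ *: x))) //.
  by move=> h; rewrite !scaler0.
split=> [x b y y' | y b x x'] /=; rewrite scaler_sumr -big_split /=;
    apply: eq_bigr => h _; last first.
  rewrite scalerDl scalerDr !scalerA; congr (_ *: _ + _).
  exact: mulrCA.
rewrite linearP /= !scalerDr !scalerA; congr (_ *: _ + _).
by rewrite mulrC mulrA.
Qed.

Lemma tens_homog_indl U V W (P : tens (U \OX V) W -> Prop) :
    P 0 -> (forall s t, P s -> P t -> P (s + t)) ->
    (forall g1 g2 g3 u v w, homog g1 u -> homog g2 v -> homog g3 w ->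
       P ((u \ox v) \ox w)) ->
  forall t, P t.
Proof.
move=> P0 PD Pp; apply: tens_ind => // x w; move: x.
apply: tens_homog_ind => [|s t Hs Ht|g1 g2 u v hu hv].
- by rewrite tpure0l.
- by rewrite tpureDl; apply: PD.
rewrite (gdecomp w) tpure_sumr; apply: big_ind => // h _.
exact: (Pp _ _ _ _ _ _ hu hv (homog_gproj h w)).
Qed.

Lemma tens_homog_indr U V W (P : tens U (V \OX W) -> Prop) :
    P 0 -> (forall s t, P s -> P t -> P (s + t)) ->
    (forall g1 g2 g3 u v w, homog g1 u -> homog g2 v -> homog g3 w ->
       P (u \ox (v \ox w))) ->
  forall t, P t.
Proof.
move=> P0 PD Pp; apply: tens_ind => // u y; move: y.
apply: tens_homog_ind => [|s t Hs Ht|g2 g3 v w hv hw].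
- by rewrite tpure0r.
- by rewrite tpureDr; apply: PD.
rewrite (gdecomp u) tpure_suml; apply: big_ind => // h _.
exact: (Pp _ _ _ _ _ _ (homog_gproj h u) hv hw).
Qed.

Lemma assocK U V W : cancel (assoc U V W) (assocV U V W).
Proof.
apply: tens_homog_indl => [|s t Hs Ht|g1 g2 g3 u v w hu hv hw].
- by rewrite !linear0.
- by rewrite !linearD /= Hs Ht.
rewrite (assocE hu hv hw) linearZ /= (assocVE hu hv hw) scalerA.
by rewrite mulVf ?scale1r ?coc3_neq0.
Qed.

Lemma assocVK U V W : cancel (assocV U V W) (assoc U V W).
Proof.
apply: tens_homog_indr => [|s t Hs Ht|g1 g2 g3 u v w hu hv hw].
- by rewrite !linear0.
- by rewrite !linearD /= Hs Ht.
rewrite (assocVE hu hv hw) linearZ /= (assocE hu hv hw) scalerA.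
by rewrite mulfV ?scale1r ?coc3_neq0.
Qed.

End VecGOmega.

Record algebra (k : fieldType) (G : finGroupType) (omega : cocycle3 k G) :=
  MkAlgebra {
  acar :> gvect k G;
  amul : 'Hom(acar \OX acar, acar);
  aunit : 'Hom(gunit k G, acar);
  amul_graded : graded amul;
  aunit_graded : graded aunit;
  amulA : (amul \o (amul \otimes \1))%VF
        = (amul \o (\1 \otimes amul) \o assoc omega acar acar acar)%VF;
  amul1l : (amul \o (aunit \otimes \1))%VF = lunitor omega acar;
  amul1r : (amul \o (\1 \otimes aunit))%VF = runitor omega acar
}.

Record bimodule (k : fieldType) (G : finGroupType) (omega : cocycle3 k G)
    (A : algebra omega) := Bimodule {
  bcar :> gvect k G;
  blact : 'Hom(A \OX bcar, bcar);
  bract : 'Hom(bcar \OX A, bcar);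
  blact_graded : graded blact;
  bract_graded : graded bract;
  blactA : (blact \o (amul A \otimes \1))%VF
         = (blact \o (\1 \otimes blact) \o assoc omega A A bcar)%VF;
  blact1 : (blact \o (aunit A \otimes \1))%VF = lunitor omega bcar;
  bractA : (bract \o (bract \otimes \1))%VF
         = (bract \o (\1 \otimes amul A) \o assoc omega bcar A A)%VF;
  bract1 : (bract \o (\1 \otimes aunit A))%VF = runitor omega bcar;
  bactA : (bract \o (blact \otimes \1))%VF
        = (blact \o (\1 \otimes bract) \o assoc omega A bcar A)%VF
}.

Section Bimodules.
Variables (k : fieldType) (G : finGroupType) (omega : cocycle3 k G).
Variable A : algebra omega.
Implicit Types M N : bimodule A.

Definition bimod_mor M N (f : 'Hom(M, N)) :=
  [/\ graded f,
      (f \o blact M)%VF = (blact N \o (\1 \otimes f))%VF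
    & (f \o bract M)%VF = (bract N \o (f \otimes \1))%VF].

(* Hom(M, N) in the category of A-bimodules, as a linear subspace of the    *)
(* linear maps M -> N; see bimod_HomP.                                      *)
Definition bimod_Hom M N : {vspace 'Hom(M, N)} :=
  (\bigcap_(g : G) lker (linfun (fun f : 'Hom(M, N) =>
       (f \o gproj M g) - (gproj N g \o f)))
   :&: lker (linfun (fun f : 'Hom(M, N) =>
       (f \o blact M) - (blact N \o (\1 \otimes f))))
   :&: lker (linfun (fun f : 'Hom(M, N) =>
       (f \o bract M) - (bract N \o (f \otimes \1)))))%VF%VS.

Lemma lker_linfunP (V W : vectType k) (p q : V -> W) v :
  linear p -> linear q ->
  reflect (p v = q v) (v \in lker (linfun (fun x => p x - q x))).
Proof.
move=> lp lq; have fP : linear (fun x => p x - q x).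
  by move=> a x y; rewrite lp lq scalerBr opprD addrACA.
pose F := GRing.isLinear.Build k V W _ (fun x => p x - q x) fP.
pose L : {linear V -> W} := HB.pack (fun x => p x - q x) F.
rewrite memv_ker (lfunE L) /= subr_eq0; exact: eqP.
Qed.

Lemma tmap_linearl (U U' V V' : vectType k) (g : 'Hom(V, V')) :
  linear (fun f : 'Hom(U, U') => f \otimes g).
Proof.
move=> a f f'; apply/lfunP; apply: tens_ind => [|s t Hs Ht|u v].
- by rewrite !linear0.
- by rewrite !linearD /= Hs Ht.
by rewrite add_lfunE scale_lfunE !tmapE add_lfunE scale_lfunE tpureDl tpureZl.
Qed.

Lemma tmap_linearr (U U' V V' : vectType k) (f : 'Hom(U, U')) :
  linear (fun g : 'Hom(V, V') => f \otimes g).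
Proof.
move=> a g g'; apply/lfunP; apply: tens_ind => [|s t Hs Ht|u v].
- by rewrite !linear0.
- by rewrite !linearD /= Hs Ht.
by rewrite add_lfunE scale_lfunE !tmapE add_lfunE scale_lfunE tpureDr tpureZr.
Qed.

Lemma bimod_HomP M N f : f \in bimod_Hom M N <-> bimod_mor f.
Proof.
have linl (U V W : vectType k) (g : 'Hom(U, V)) :
    linear (fun f : 'Hom(V, W) => (f \o g)%VF).
  by move=> a x y; rewrite comp_lfunDl comp_lfunZl.
have linr (U V W : vectType k) (g : 'Hom(V, W)) :
    linear (fun f : 'Hom(U, V) => (g \o f)%VF).
  by move=> a x y; rewrite comp_lfunDr comp_lfunZr.
rewrite /bimod_Hom !memv_cap; split.
  case/andP=> [/andP[/subv_bigcapP fg fl] fr]; split.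
  - move=> g u; have := fg g isT.
    move/lker_linfunP => /(_ (linl _ _ _ _) (linr _ _ _ _)).
    by move/lfunP/(_ u); rewrite !comp_lfunE.
  - apply/lker_linfunP: fl => [|a x y]; first exact: linl.
    by rewrite tmap_linearr linr.
  apply/lker_linfunP: fr => [|a x y]; first exact: linl.
  by rewrite tmap_linearl linr.
case=> fg fl fr; apply/andP; split; [apply/andP; split|].
- apply/subv_bigcapP => g _; apply/lker_linfunP; [exact: linl|exact: linr|].
  by apply/lfunP=> u; rewrite !comp_lfunE.
- by apply/lker_linfunP => // [|a x y]; [exact: linl|rewrite tmap_linearr linr].
by apply/lker_linfunP => // [|a x y]; [exact: linl|rewrite tmap_linearl linr].
Qed.

(* A as a bimodule over itself: the unit object of the category of          *)
(* A-bimodules.                                                             *)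
Definition bimod_unit : bimodule A :=
  Bimodule (@amul_graded _ _ _ A) (@amul_graded _ _ _ A) (amulA A) (amul1l A)
    (amulA A) (amul1r A) (amulA A).

Definition connected (B : bimodule A) := \dim (bimod_Hom bimod_unit B) = 1%N.

Section FreeBimodule.
Variable X : gvect k G.

Definition free_lact :
    'Hom(A \OX ((A \OX X) \OX A), (A \OX X) \OX A) :=
  ((((amul A \otimes \1) \o assocV omega A A X) \otimes \1)
     \o assocV omega A (A \OX X) A)%VF.

Definition free_ract :
    'Hom(((A \OX X) \OX A) \OX A, (A \OX X) \OX A) :=
  ((\1 \otimes amul A) \o assoc omega (A \OX X) A A)%VF.

Local Notation m x y := (amul A (x \ox y)).

Lemma homog_mul g h (x y : A) :
  homog g x -> homog h y -> homog (g * h)%g (m x y).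
Proof.
by move=> hx hy; apply: graded_homog (@amul_graded _ _ _ A) (homog_tpure hx hy).
Qed.

Lemma homog_unit (c : gunit k G) : homog 1%g (aunit A c).
Proof. exact: graded_homog (@aunit_graded _ _ _ A) (homog_gunit c). Qed.

Lemma mulAE g1 g2 g3 (x y z : A) : homog g1 x -> homog g2 y -> homog g3 z ->
  m (m x y) z = (omega g1 g2 g3)^-1 *: m x (m y z).
Proof.
move=> hx hy hz; have /lfunP/(_ ((x \ox y) \ox z)) := amulA A.
rewrite !comp_lfunE tmapE id_lfunE (assocE _ hx hy hz) !linearZ /=.
by rewrite tmapE id_lfunE.
Qed.

Lemma mul1E g c (x : A) : homog g x -> m (aunit A c) x = (c : k) *: x.
Proof.
move=> hx; have /lfunP/(_ (c \ox x)) := amul1l A.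
rewrite comp_lfunE tmapE id_lfunE (lunitorE _ _ hx) => ->.
by have [-> _ _] := coc3_norm omega 1%g g; rewrite invr1 scale1r.
Qed.

Lemma mulE1 g c (x : A) : homog g x -> m x (aunit A c) = (c : k) *: x.
Proof.
move=> hx; have /lfunP/(_ (x \ox c)) := amul1r A.
rewrite comp_lfunE tmapE id_lfunE (runitorE _ _ hx) => ->.
by have [_ -> _] := coc3_norm omega g 1%g; rewrite scale1r.
Qed.

Lemma free_lactE g h d l (x a b : A) (u : X) :
    homog g x -> homog h a -> homog d u -> homog l b ->
  free_lact (x \ox ((a \ox u) \ox b))
  = (omega g (h * d)%g l * omega g h d) *: ((m x a \ox u) \ox b).
Proof.
move=> hx ha hu hb; rewrite /free_lact comp_lfunE.
rewrite (assocVE _ hx (homog_tpure ha hu) hb) linearZ /= tmapE id_lfunE.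
rewrite comp_lfunE (assocVE _ hx ha hu) linearZ /= tmapE id_lfunE.
by rewrite tpureZl scalerA.
Qed.

Lemma free_ractE h d l g (x a b : A) (u : X) :
    homog h a -> homog d u -> homog l b -> homog g x ->
  free_ract (((a \ox u) \ox b) \ox x)
  = (omega (h * d)%g l g)^-1 *: ((a \ox u) \ox m b x).
Proof.
move=> ha hu hb hx; rewrite /free_ract comp_lfunE.
by rewrite (assocE _ (homog_tpure ha hu) hb hx) linearZ /= tmapE id_lfunE.
Qed.

Lemma graded_comp (U V W : gvect k G) (f : 'Hom(V, W)) (g : 'Hom(U, V)) :
  graded f -> graded g -> graded (f \o g)%VF.
Proof. by move=> gf gg h u; rewrite !comp_lfunE gg gf. Qed.

Lemma gradedP (U V : gvect k G) (f : 'Hom(U, V)) :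
  (forall g u, homog g u -> homog g (f u)) -> graded f.
Proof.
move=> fP g u; rewrite {2}(gdecomp u) !linear_sum /= (bigD1 g) //=.
rewrite big1 ?addr0 => [|h hg].
  by rewrite (gproj_homog _ (fP _ _ (homog_gproj g u))) eqxx.
by rewrite (gproj_homog _ (fP _ _ (homog_gproj h u))) eq_sym (negPf hg).
Qed.

Lemma graded_tens (U V W : gvect k G) (f : 'Hom(U \OX V, W)) :
  (forall g h u v, homog g u -> homog h v -> homog (g * h)%g (f (u \ox v))) ->
  graded f.
Proof.
move=> fP g; apply: tens_homog_ind => [|s t Hs Ht|h1 h2 u v hu hv].
- by rewrite !linear0.
- by rewrite !linearD /= Hs Ht.
rewrite (gproj_homog _ (homog_tpure hu hv)) (gproj_homog _ (fP _ _ _ _ hu hv)).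
by case: ifP; rewrite ?linear0.
Qed.

Lemma free_ind (P : tens (A \OX X) A -> Prop) :
    P 0 -> (forall s t, P s -> P t -> P (s + t)) ->
    (forall h d l (a b : A) (u : X), homog h a -> homog d u -> homog l b ->
       P ((a \ox u) \ox b)) ->
  forall t, P t.
Proof.
move=> P0 PD Pp; apply: tens_homog_indl => // h d l a u b ha hu hb.
exact: Pp ha hu hb.
Qed.

Lemma homog_free h d l (a b : A) (u : X) :
  homog h a -> homog d u -> homog l b ->
  @homog _ _ ((A \OX X) \OX A) (h * d * l)%g ((a \ox u) \ox b).
Proof. by move=> ha hu hb; apply/homog_tpure/hb/homog_tpure. Qed.

Lemma free_lact_graded : graded free_lact.
Proof.
move=> g; apply: tens_ind => [|s t Hs Ht|x t]; first by rewrite !linear0.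
  by rewrite !linearD /= Hs Ht.
rewrite (gdecomp x) tpure_suml !linear_sum /=; apply: eq_bigr => h0 _.
move: (gproj A h0 x) (homog_gproj h0 x) => {}x hx; move: t.
apply: free_ind => [|s t Hs Ht|h d l a b u ha hu hb].
- by rewrite !tpure0r !linear0.
- by rewrite !tpureDr !linearD /= Hs Ht.
have hF := homog_tpure hx (homog_free ha hu hb).
rewrite (gproj_homog _ hF) (free_lactE hx ha hu hb) linearZ /=.
rewrite (gproj_homog _ (homog_free (homog_mul hx ha) hu hb)) !mulgA.
by case: ifP => _; rewrite ?linear0 ?scaler0 // (free_lactE hx ha hu hb).
Qed.

Lemma free_ract_graded : graded free_ract.
Proof.
move=> g; apply: tens_ind => [|s t Hs Ht|t x]; first by rewrite !linear0.
  by rewrite !linearD /= Hs Ht.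
rewrite (gdecomp x) tpure_sumr !linear_sum /=; apply: eq_bigr => h0 _.
move: (gproj A h0 x) (homog_gproj h0 x) => {}x hx; move: t.
apply: free_ind => [|s t Hs Ht|h d l a b u ha hu hb].
- by rewrite !tpure0l !linear0.
- by rewrite !tpureDl !linearD /= Hs Ht.
have hF := homog_tpure (homog_free ha hu hb) hx.
rewrite (gproj_homog _ hF) (free_ractE ha hu hb hx) linearZ /=.
rewrite (gproj_homog _ (homog_free ha hu (homog_mul hb hx))) !mulgA.
by case: ifP => _; rewrite ?linear0 ?scaler0 // (free_ractE ha hu hb hx).
Qed.

Local Notation F := ((A \OX X) \OX A).

Lemma cocycle_scalars (U P R V Z T W S Q : k) :
  R != 0 -> V != 0 -> Q != 0 -> P * Q = R * S * T -> U * V = Q * W * Z ->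
  U * P / R = V^-1 * (Z * T) * (W * S).
Proof.
move=> R0 V0 Q0 /(canRL (mulfK Q0))-> /(canRL (mulfK V0))->; field.
by rewrite R0 V0.
Qed.

Lemma cocycle_scalars2 (P Q R S T Z : k) :
  P != 0 -> S != 0 -> T != 0 -> P * Q = R * S * T ->
  R * Z / P = S^-1 / T * (Q * Z).
Proof.
move=> P0 S0 T0; rewrite mulrC => /(canRL (mulfK P0))->; field.
by rewrite P0 S0 T0.
Qed.

Lemma free_lactA : (free_lact \o (amul A \otimes \1))%VF
  = (free_lact \o (\1 \otimes free_lact) \o assoc omega A A F)%VF.
Proof.
apply/lfunP; apply: tens_ind => [|s t Hs Ht|xy t]; first by rewrite !linear0.
  by rewrite !linearD /= Hs Ht.
move: xy; apply: tens_homog_ind => [|xy xy' H H'|g g' x y hx hy].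
- by rewrite tpure0l !linear0.
- by rewrite tpureDl !linearD /= H H'.
move: t; apply: free_ind => [|s t Hs Ht|h d l a b u ha hu hb].
- by rewrite tpure0r !linear0.
- by rewrite tpureDr !linearD /= Hs Ht.
rewrite [LHS]comp_lfunE [RHS]comp_lfunE [RHS]comp_lfunE tmapE id_lfunE (free_lactE (homog_mul hx hy) ha hu hb).
rewrite (assocE _ hx hy (homog_free ha hu hb)) !linearZ /= tmapE id_lfunE.
rewrite (free_lactE hy ha hu hb) tpureZr linearZ /=.
rewrite (free_lactE hx (homog_mul hy ha) hu hb) (mulAE hx hy ha).
rewrite !tpureZl !scalerA; congr (_ *: _).
have E1 := coc3P omega g g' h d; have E2 := coc3P omega g g' (h * d) l.
rewrite !mulgA in E1 E2 *.
by apply: cocycle_scalars E1 E2; apply: coc3_neq0.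
Qed.

Lemma free_lact1 :
  (free_lact \o (aunit A \otimes \1))%VF = lunitor omega F.
Proof.
apply/lfunP; apply: tens_ind => [|s t Hs Ht|c t]; first by rewrite !linear0.
  by rewrite !linearD /= Hs Ht.
move: t; apply: free_ind => [|s t Hs Ht|h d l a b u ha hu hb].
- by rewrite tpure0r !linear0.
- by rewrite tpureDr !linearD /= Hs Ht.
rewrite [LHS]comp_lfunE tmapE id_lfunE (free_lactE (homog_unit c) ha hu hb).
rewrite (lunitorE _ _ (homog_free ha hu hb)) (mul1E _ ha) !tpureZl.
have n g1 g2 : omega 1%g g1 g2 = 1 by have [] := coc3_norm omega g1 g2.
by rewrite !n mul1r invr1.
Qed.

Lemma free_ractA : (free_ract \o (free_ract \otimes \1))%VF
  = (free_ract \o (\1 \otimes amul A) \o assoc omega F A A)%VF.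
Proof.
apply/lfunP; apply: tens_homog_indl => [|s t Hs Ht|g0 g g' t x y _ hx hy].
- by rewrite !linear0.
- by rewrite !linearD /= Hs Ht.
move: t; apply: free_ind => [|s t Hs Ht|h d l a b u ha hu hb].
- by rewrite !tpure0l !linear0.
- by rewrite !tpureDl !linearD /= Hs Ht.
rewrite [LHS]comp_lfunE [RHS]comp_lfunE [RHS]comp_lfunE tmapE id_lfunE (free_ractE ha hu hb hx).
rewrite (assocE _ (homog_free ha hu hb) hx hy) tpureZl !linearZ /=.
rewrite tmapE id_lfunE (free_ractE ha hu (homog_mul hb hx) hy).
rewrite (free_ractE ha hu hb (homog_mul hx hy)) (mulAE hb hx hy).
rewrite !tpureZr !scalerA; congr (_ *: _).
have E1 := coc3P omega (h * d) l g g'; rewrite ?mulgA in E1.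
by rewrite -!invfM E1.
Qed.

Lemma free_ract1 :
  (free_ract \o (\1 \otimes aunit A))%VF = runitor omega F.
Proof.
apply/lfunP; apply: tens_ind => [|s t Hs Ht|t c]; first by rewrite !linear0.
  by rewrite !linearD /= Hs Ht.
move: t; apply: free_ind => [|s t Hs Ht|h d l a b u ha hu hb].
- by rewrite tpure0l !linear0.
- by rewrite tpureDl !linearD /= Hs Ht.
rewrite [LHS]comp_lfunE tmapE id_lfunE (free_ractE ha hu hb (homog_unit c)).
rewrite (runitorE _ _ (homog_free ha hu hb)) (mulE1 _ hb) !tpureZr.
have n g1 g2 : omega g1 g2 1%g = 1 by have [] := coc3_norm omega g1 g2.
by rewrite !n invr1.
Qed.

Lemma free_actA : (free_ract \o (free_lact \otimes \1))%VF
  = (free_lact \o (\1 \otimes free_ract) \o assoc omega A F A)%VF.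
Proof.
apply/lfunP; apply: tens_homog_indl => [|s t Hs Ht|g g0 g' x t y hx _ hy].
- by rewrite !linear0.
- by rewrite !linearD /= Hs Ht.
move: t; apply: free_ind => [|s t Hs Ht|h d l a b u ha hu hb].
- by rewrite tpure0r !tpure0l !linear0.
- by rewrite tpureDr !tpureDl !linearD /= Hs Ht.
rewrite [LHS]comp_lfunE [RHS]comp_lfunE [RHS]comp_lfunE tmapE id_lfunE (free_lactE hx ha hu hb).
rewrite (assocE _ hx (homog_free ha hu hb) hy) tpureZl !linearZ /=.
rewrite tmapE id_lfunE (free_ractE (homog_mul hx ha) hu hb hy).
rewrite (free_ractE ha hu hb hy) tpureZr [free_lact (_ *: _)]linearZ /=.
rewrite (free_lactE hx ha hu (homog_mul hb hy)) !scalerA; congr (_ *: _).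
have E1 := coc3P omega g (h * d) l g'; rewrite !mulgA in E1 *.
by apply: cocycle_scalars2 E1; apply: coc3_neq0.
Qed.

Definition free_bimod : bimodule A :=
  @Bimodule _ _ _ A F free_lact free_ract free_lact_graded free_ract_graded
    free_lactA free_lact1 free_ractA free_ract1 free_actA.

End FreeBimodule.
End Bimodules.

Section TwistedGroupAlgebra.
Variables (k : fieldType) (G : finGroupType) (omega : cocycle3 k G).
Variables (N : {group G}) (theta : cochain2 k (subg_of N)).
Hypothesis dtheta : cobounds omega theta.

Definition tga_space : gvect k G := gfree k (@sgval G N).

Definition tga_mul : 'Hom(tga_space \OX tga_space, tga_space) :=
  tlift (fun u v : {ffun subg_of N -> k^o} =>
    \sum_f1 \sum_f2 ((u f1 : k) * v f2 * theta f1 f2) *: gdelta k (f1 * f2)%g).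

Definition tga_unit : 'Hom(gunit k G, tga_space) :=
  linfun (fun a : k^o => (a : k) *: gdelta k (1%g : subg_of N)).

Lemma tga_mulE f1 f2 :
  tga_mul (gdelta k f1 \ox gdelta k f2) = theta f1 f2 *: gdelta k (f1 * f2)%g.
Proof.
rewrite /tga_mul tliftE.
  rewrite (bigD1 f1) //= [X in _ + X]big1 ?addr0 => [|i i1].
    rewrite (bigD1 f2) //= [X in _ + X]big1 ?addr0 => [|j j2].
      by rewrite !ffunE !eqxx !mul1r.
    by rewrite !ffunE (negPf j2) mulr0 mul0r scale0r.
  by rewrite big1 // => j _; rewrite ffunE (negPf i1) !mul0r scale0r.
split=> [v a x y | u a x y] /=; rewrite scaler_sumr -big_split /=;
  apply: eq_bigr => i _; rewrite scaler_sumr -big_split /=;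
  apply: eq_bigr => j _; rewrite !ffunE scalerA -scalerDl; congr (_ *: _).
  by rewrite !mulrDl !mulrA.
by rewrite mulrDr mulrDl; congr (_ + _); rewrite -!mulrA [LHS]mulrCA.
Qed.

Lemma tga_unitE a : tga_unit a = (a : k) *: gdelta k (1%g : subg_of N).
Proof.
pose f (a : k^o) := (a : k) *: gdelta k (1%g : subg_of N).
have fP : linear f by move=> b x y; rewrite /f scalerDl scalerA.
pose F := GRing.isLinear.Build k k^o {ffun subg_of N -> k^o} _ f fP.
pose L : {linear k^o -> {ffun subg_of N -> k^o}} := HB.pack f F.
exact: (lfunE L a).
Qed.

Let hd := @homog_gdelta k G _ (@sgval G N).

Lemma tga_mul_graded : graded tga_mul.
Proof.
move=> g; apply: tens_ind => [|s t Hs Ht|u v]; first by rewrite !linear0.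
  by rewrite !linearD /= Hs Ht.
move: u; apply: gfree_ind => [|s t Hs Ht|a i].
- by rewrite tpure0l !linear0.
- by rewrite tpureDl !linearD /= Hs Ht.
move: v; apply: gfree_ind => [|s t Hs Ht|b j].
- by rewrite tpure0r !linear0.
- by rewrite tpureDr !linearD /= Hs Ht.
rewrite !(tpureZl, tpureZr, linearZ) /=; congr (_ *: (_ *: _)).
rewrite tga_mulE linearZ /= (gproj_homog _ (homog_tpure (hd i) (hd j))).
rewrite (gproj_homog _ (hd (i * j)%g)).
by case: ifP; rewrite ?linear0 ?scaler0 ?tga_mulE.
Qed.

Lemma tga_unit_graded : graded tga_unit.
Proof.
apply: gradedP => g u hu; rewrite tga_unitE.
case: (g =P 1%g) => [-> | /eqP/negPf g1]; first exact/homogZ/(hd 1%g).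
by move: hu; rewrite /homog /= /gunit_proj g1 zero_lfunE => <-; rewrite scale0r linear0.
Qed.

Lemma tga_mulA : (tga_mul \o (tga_mul \otimes \1))%VF
  = (tga_mul \o (\1 \otimes tga_mul)
       \o assoc omega tga_space tga_space tga_space)%VF.
Proof.
apply/lfunP; apply: tens_ind => [|s t Hs Ht|uv w]; first by rewrite !linear0.
  by rewrite !linearD /= Hs Ht.
move: uv; apply: tens_ind => [|s t Hs Ht|u v].
- by rewrite tpure0l !linear0.
- by rewrite tpureDl !linearD /= Hs Ht.
move: u; apply: gfree_ind => [|s t Hs Ht|a i].
- by rewrite !tpure0l !linear0.
- by rewrite !tpureDl !linearD /= Hs Ht.
move: v; apply: gfree_ind => [|s t Hs Ht|b j].
- by rewrite tpure0r tpure0l !linear0.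
- by rewrite tpureDr tpureDl !linearD /= Hs Ht.
move: w; apply: gfree_ind => [|s t Hs Ht|c l].
- by rewrite tpure0r !linear0.
- by rewrite tpureDr !linearD /= Hs Ht.
rewrite !(tpureZl, tpureZr, linearZ) /=; congr (_ *: (_ *: (_ *: _))).
rewrite [LHS]comp_lfunE [RHS]comp_lfunE [RHS]comp_lfunE tmapE id_lfunE (assocE _ (hd i) (hd j) (hd l)).
rewrite !linearZ /= tmapE id_lfunE !tga_mulE tpureZl tpureZr !linearZ /=.
rewrite !tga_mulE !scalerA mulgA; congr (_ *: _).
have E := dtheta i j l.
rewrite [RHS]mulrAC [theta j l * _]mulrC E; field; exact: coc3_neq0.
Qed.

Lemma tga_mul1l : (tga_mul \o (tga_unit \otimes \1))%VF
  = lunitor omega tga_space.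
Proof.
apply/lfunP; apply: tens_ind => [|s t Hs Ht|c v]; first by rewrite !linear0.
  by rewrite !linearD /= Hs Ht.
move: v; apply: gfree_ind => [|s t Hs Ht|b j].
- by rewrite tpure0r !linear0.
- by rewrite tpureDr !linearD /= Hs Ht.
rewrite !(tpureZr, linearZ) /=; congr (_ *: _).
rewrite [LHS]comp_lfunE tmapE id_lfunE tga_unitE (lunitorE _ _ (hd j)) tpureZl.
rewrite linearZ /= tga_mulE mul1g (coch2_norm theta j).1 scale1r.
by have [-> _ _] := coc3_norm omega 1%g (sgval j); rewrite invr1 scale1r.
Qed.

Lemma tga_mul1r : (tga_mul \o (\1 \otimes tga_unit))%VF
  = runitor omega tga_space.
Proof.
apply/lfunP; apply: tens_ind => [|s t Hs Ht|v c]; first by rewrite !linear0.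
  by rewrite !linearD /= Hs Ht.
move: v; apply: gfree_ind => [|s t Hs Ht|b j].
- by rewrite tpure0l !linear0.
- by rewrite tpureDl !linearD /= Hs Ht.
rewrite !(tpureZl, linearZ) /=; congr (_ *: _).
rewrite [LHS]comp_lfunE tmapE id_lfunE tga_unitE (runitorE _ _ (hd j)) tpureZr.
rewrite linearZ /= tga_mulE mulg1 (coch2_norm theta j).2 scale1r.
by have [_ -> _] := coc3_norm omega (sgval j) 1%g; rewrite scale1r.
Qed.

Definition tga : algebra omega :=
  MkAlgebra tga_mul_graded tga_unit_graded tga_mulA tga_mul1l tga_mul1r.

End TwistedGroupAlgebra.

(* The A(K, beta)-bimodule underlying A^{K, beta}(L, psi).                  *)
Definition hecke (k : fieldType) (G : finGroupType) (omega : cocycle3 k G)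
    (K L : {group G}) (beta : cochain2 k (subg_of K))
    (psi : cochain2 k (subg_of L))
    (dbeta : cobounds omega beta) (dpsi : cobounds omega psi) :
    bimodule (tga dbeta) :=
  free_bimod (tga dbeta) (tga dpsi).

(* Main.v *)
(* A bimodule map f : A -> (A (x) X) (x) A, with A = A(K, beta) and
   X = A(L, psi), is determined by the coefficients phi(i) of
   (delta_1 (x) delta_i) (x) delta_1 in f(delta_i), for i in K :&: L: the
   grading kills the coefficient of (delta_p (x) delta_l) (x) delta_q in
   f(delta_x) unless p l q = x, which forces l to lie in K :&: L, and then
   delta_x is proportional to delta_p (delta_l delta_q), so that this
   coefficient is phi(l) omega(p, l, q) / (beta(l, q) beta(p, lq)).
   Conversely, for every phi this formula defines a bimodule map, by the
   cocycle identity at (y, p, l, q) for the left action and at (p, l, q, y)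
   for the right action, combined with d beta = omega. *)
Require Import Defs.
From HB Require Import structures.
From mathcomp Require Import all_boot all_order all_algebra all_fingroup.
From mathcomp Require Import ring.

Set Implicit Arguments.
Unset Strict Implicit.
Unset Printing Implicit Defensive.

Import GRing.Theory.

Section HeckeHom.
(* Otherwise /= exposes free_lact and free_ract. *)
Local Arguments blact : simpl never.
Local Arguments bract : simpl never.
Local Open Scope ring_scope.
Variables (k : fieldType) (G : finGroupType) (omega : cocycle3 k G).
Variables (K L : {group G}) (beta : cochain2 k (subg_of K)).
Variables (psi : cochain2 k (subg_of L)).
Variables (dbeta : cobounds omega beta) (dpsi : cobounds omega psi).

Local Notation A := (tga dbeta).
Local Notation X := (tga dpsi).
Local Notation F := (hecke dbeta dpsi).
Local Notation I := (subg_of (K :&: L)%G).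

(** * Basis vectors of the free bimodule and the two actions on them *)

Definition deltaA (p : subg_of K) : A := gdelta k p.
Definition deltaX (l : subg_of L) : X := gdelta k l.
Definition hecke_delta p l q : F := (deltaA p \ox deltaX l) \ox deltaA q.

Lemma homog_deltaA p : homog (sgval p) (deltaA p).
Proof. exact: homog_gdelta. Qed.
Lemma homog_deltaX l : homog (sgval l) (deltaX l).
Proof. exact: homog_gdelta. Qed.

Lemma amul_delta x y :
  amul A (deltaA x \ox deltaA y) = beta x y *: deltaA (x * y)%g.
Proof. exact: tga_mulE. Qed.

(** The two values of [omega] come from the two inverse associators that bring [deltaA y] next to
    [deltaA p], and [beta y p] from the product of these two. *)
Lemma blact_delta y p l q : blact F (deltaA y \ox hecke_delta p l q)
  = (omega (sgval y) (sgval p * sgval l)%g (sgval q)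
     * omega (sgval y) (sgval p) (sgval l) * beta y p)
    *: hecke_delta (y * p)%g l q.
Proof.
rewrite [LHS](free_lactE (homog_deltaA y) (homog_deltaA p) (homog_deltaX l)
  (homog_deltaA q)).
by rewrite amul_delta !tpureZl scalerA.
Qed.

Lemma bract_delta y p l q : bract F (hecke_delta p l q \ox deltaA y)
  = ((omega (sgval p * sgval l)%g (sgval q) (sgval y))^-1 * beta q y)
    *: hecke_delta p l (q * y)%g.
Proof.
rewrite [LHS](free_ractE (homog_deltaA p) (homog_deltaX l) (homog_deltaA q)
  (homog_deltaA y)).
by rewrite amul_delta !tpureZr scalerA.
Qed.

Lemma blactZ_delta a y p l q :
  blact F (deltaA y \ox (a *: hecke_delta p l q))
  = (a * (omega (sgval y) (sgval p * sgval l)%g (sgval q)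
          * omega (sgval y) (sgval p) (sgval l) * beta y p))
    *: hecke_delta (y * p)%g l q.
Proof. by rewrite tpureZr linearZ /= blact_delta scalerA. Qed.

Lemma bractZ_delta a y p l q :
  bract F ((a *: hecke_delta p l q) \ox deltaA y)
  = (a * ((omega (sgval p * sgval l)%g (sgval q) (sgval y))^-1 * beta q y))
    *: hecke_delta p l (q * y)%g.
Proof. by rewrite tpureZl linearZ /= bract_delta scalerA. Qed.

Lemma homog_hecke_delta p l q :
  homog (sgval p * sgval l * sgval q)%g (hecke_delta p l q).
Proof. exact: homog_free (homog_deltaA p) (homog_deltaX l) (homog_deltaA q). Qed.

Lemma deltaA_ind (P : A -> Prop) :
    P 0 -> (forall s t, P s -> P t -> P (s + t)) ->
    (forall a p, P (a *: deltaA p)) -> forall t, P t.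
Proof. exact: gfree_ind. Qed.

Lemma hecke_ind (P : F -> Prop) :
    P 0 -> (forall s t, P s -> P t -> P (s + t)) ->
    (forall a p l q, P (a *: hecke_delta p l q)) ->
  forall t, P t.
Proof.
move=> P0 PD Pd; apply: tens_ind => // x w; move: x.
apply: tens_ind => [|s t Hs Ht|u v].
- by rewrite tpure0l.
- by rewrite tpureDl; apply: PD.
move: u; apply: gfree_ind => [|s t Hs Ht|a p].
- by rewrite !tpure0l.
- by rewrite !tpureDl; apply: PD.
move: v; apply: gfree_ind => [|s t Hs Ht|b l].
- by rewrite tpure0r tpure0l.
- by rewrite tpureDr tpureDl; apply: PD.
move: w; apply: gfree_ind => [|s t Hs Ht|c q].
- by rewrite tpure0r.
- by rewrite tpureDr; apply: PD.
by rewrite !(tpureZl, tpureZr) !scalerA; apply: Pd.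
Qed.

(** * Coordinates in the free bimodule *)

Definition hecke_coef p l q : 'Hom(F, k^o) :=
  tlift (fun (x : tens A X) (w : {ffun subg_of K -> k^o}) =>
    tlift (fun (u : {ffun subg_of K -> k^o}) (v : {ffun subg_of L -> k^o}) =>
      (u p : k^o) * v l) x * w q).

Lemma hecke_coef_delta p l q p' l' q' : hecke_coef p l q (hecke_delta p' l' q')
  = [&& p == p', l == l' & q == q']%:R.
Proof.
have bl (U V : finType) (i : U) (j : V) :
    bilin (fun (u : {ffun U -> k^o}) (v : {ffun V -> k^o}) => (u i : k^o) * v j).
  split=> [v a x y | u a x y] /=; rewrite !ffunE; first by rewrite mulrDl -mulrA.
  by rewrite mulrDr; congr (_ + _); exact: mulrCA.
rewrite /hecke_coef tliftE; last first.
  split=> [w a x y | x a w w'] /=.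
    by rewrite linearP /= mulrDl; congr (_ + _); rewrite -mulrA.
  by rewrite !ffunE mulrDr; congr (_ + _); exact: mulrCA.
rewrite tliftE; last exact: bl.
by rewrite !ffunE -!natrM !mulnb andbA.
Qed.

Lemma hecke_decomp t :
  t = \sum_p \sum_l \sum_q (hecke_coef p l q t : k) *: hecke_delta p l q.
Proof.
move: t; apply: hecke_ind => [|s t Hs Ht|a p l q].
- by rewrite big1 // => p _; rewrite big1 // => l _; rewrite big1 // => q _;
    rewrite linear0 scale0r.
- rewrite {1}Hs {1}Ht -big_split; apply: eq_bigr => p _ /=.
  rewrite -big_split; apply: eq_bigr => l _ /=.
  rewrite -big_split; apply: eq_bigr => q _ /=.
  by rewrite linearD /= scalerDl.
have E p' l' q' : (hecke_coef p' l' q' (a *: hecke_delta p l q) : k)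
    = a * [&& p' == p, l' == l & q' == q]%:R.
  by rewrite linearZ /= hecke_coef_delta.
rewrite (bigD1 p) //= [X in _ + X]big1 ?addr0; last first.
  by move=> p' /negPf n; rewrite big1 // => l' _; rewrite big1 // => q' _;
    rewrite E n mulr0 scale0r.
rewrite (bigD1 l) //= [X in _ + X]big1 ?addr0; last first.
  by move=> l' /negPf n; rewrite big1 // => q' _; rewrite E n andbF mulr0 scale0r.
rewrite (bigD1 q) //= [X in _ + X]big1 ?addr0; last first.
  by move=> q' /negPf n; rewrite E n !andbF mulr0 scale0r.
by rewrite E !eqxx mulr1.
Qed.

Lemma hecke_coef_inj s t :
  (forall p l q, hecke_coef p l q s = hecke_coef p l q t) -> s = t.
Proof.
move=> E; rewrite (hecke_decomp s) (hecke_decomp t).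
by do 3!(apply: eq_bigr => ? _); rewrite E.
Qed.

Lemma hecke_coef_homog g t p l q : homog g t ->
  (sgval p * sgval l * sgval q)%g != g -> hecke_coef p l q t = 0.
Proof.
(* Replacing [t] by its projection to degree [g] lets the induction run over arbitrary vectors, not
   only homogeneous ones. *)
move=> <- ne; move: t; apply: hecke_ind => [|s t Hs Ht|a p' l' q'].
- by rewrite !linear0.
- by rewrite !linearD /= Hs Ht addr0.
rewrite linearZ /= (gproj_homog _ (homog_hecke_delta p' l' q')) linearZ /=.
case: eqP => [def_g|_]; last by rewrite linear0 scaler0.
rewrite hecke_coef_delta; case: and3P => [[/eqP pp /eqP ll /eqP qq]|_].
  by rewrite pp ll qq def_g eqxx in ne.
exact: mulr0.
Qed.

(** Up to scalars, acting by [deltaA y] moves basis vectors by the injective shift of [p] to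
    [y * p], so a single coefficient of [t] contributes. *)
Lemma hecke_coef_lact y p l q t :
  hecke_coef (y * p)%g l q (blact F (deltaA y \ox t))
  = (omega (sgval y) (sgval p * sgval l)%g (sgval q)
     * omega (sgval y) (sgval p) (sgval l) * beta y p) * hecke_coef p l q t.
Proof.
move: t; apply: hecke_ind => [|s t Hs Ht|a p' l' q'].
- by rewrite tpure0r !linear0 mulr0.
- by rewrite tpureDr !linearD /= Hs Ht mulrDr.
rewrite tpureZr !linearZ /= blact_delta linearZ /= !hecke_coef_delta.
rewrite (inj_eq (mulgI y)).
case: and3P => [[/eqP <- /eqP <- /eqP <-]|_]; last by rewrite !scaler0 mulr0.
exact: mulrCA.
Qed.

Lemma hecke_coef_ract y p l q t :
  hecke_coef p l (q * y)%g (bract F (t \ox deltaA y))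
  = ((omega (sgval p * sgval l)%g (sgval q) (sgval y))^-1 * beta q y)
    * hecke_coef p l q t.
Proof.
move: t; apply: hecke_ind => [|s t Hs Ht|a p' l' q'].
- by rewrite tpure0l !linear0 mulr0.
- by rewrite tpureDl !linearD /= Hs Ht mulrDr.
rewrite tpureZl !linearZ /= bract_delta linearZ /= !hecke_coef_delta.
rewrite (inj_eq (mulIg y)).
case: and3P => [[/eqP <- /eqP <- /eqP <-]|_]; last by rewrite !scaler0 mulr0.
exact: mulrCA.
Qed.

(** * The bimodule map attached to a function on the intersection *)

Definition toK (i : I) : subg_of K := subg K (sgval i).
Definition toL (i : I) : subg_of L := subg L (sgval i).

(** Membership in the intersection excludes the default value 1 that [subg] takes outside the
    group. *)
Lemma sgval_toK i : sgval (toK i) = sgval i.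
Proof. by rewrite /toK subgK //; have /setIP[] := subgP i. Qed.
Lemma sgval_toL i : sgval (toL i) = sgval i.
Proof. by rewrite /toL subgK //; have /setIP[] := subgP i. Qed.

(** By normalization, the right action of [q] on the triple [(1, i, 1)] has scalar 1 and the left
    action of [p] on [(1, i, q)] has scalar [omega p i q]; the denominator arises from writing the
    basis vector at [p * (i * q)] as a product. *)
Definition hom_scalar p i q : k :=
  omega (sgval p) (sgval i) (sgval q) / (beta (toK i) q * beta p (toK i * q)%g).

(** Reading [v] at [p * (i * q)] encodes the degree constraint without a restricted sum and keeps
    the formula visibly linear in [phi] and in [v]. *)
Definition hecke_hom_fun (phi : {ffun I -> k^o}) (v : A) : F :=
  \sum_p \sum_i \sum_q (((phi i : k) * hom_scalar p i q)
    * (v : {ffun subg_of K -> k^o}) (p * (toK i * q))%g) *: hecke_delta p (toL i) q.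

Definition hecke_hom phi : 'Hom(bimod_unit A, F) := linfun (hecke_hom_fun phi).

Lemma hecke_homE phi v : hecke_hom phi v = hecke_hom_fun phi v.
Proof.
have fP : linear (hecke_hom_fun phi).
  move=> a x y; rewrite /hecke_hom_fun.
  do 3!(rewrite scaler_sumr -big_split /=; apply: eq_bigr => ? _).
  rewrite !ffunE scalerA -scalerDl; congr (_ *: _).
  by rewrite mulrDr; congr (_ + _); exact: mulrCA.
pose H := GRing.isLinear.Build k A F _ (hecke_hom_fun phi) fP.
pose H' : {linear A -> F} := HB.pack (hecke_hom_fun phi) H.
exact: (lfunE H' v).
Qed.

Lemma hecke_hom_delta phi x : hecke_hom phi (deltaA x) =
  \sum_p \sum_i \sum_q (((phi i : k) * hom_scalar p i q)
    * (p * (toK i * q) == x)%g%:R) *: hecke_delta p (toL i) q.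
Proof.
by rewrite hecke_homE; do 3!(apply: eq_bigr => ? _); rewrite ffunE.
Qed.

(** Left translation changes only the outer [beta] of the denominator, so one instance of [dbeta]
    suffices; its [omega] cancels against the cocycle identity. *)
Lemma hom_scalar_mull y p i q :
  beta y (p * (toK i * q))%g * hom_scalar (y * p)%g i q
  = hom_scalar p i q * (omega (sgval y) (sgval p * sgval i)%g (sgval q)
     * omega (sgval y) (sgval p) (sgval i) * beta y p).
Proof.
have /= E1 := dbeta y p (toK i * q)%g; rewrite sgval_toK in E1.
have /= E2 := coc3P omega (sgval y) (sgval p) (sgval i) (sgval q).
rewrite /hom_scalar.
have b0 := coch2_neq0 beta (toK i) q.
have b1 := coch2_neq0 beta (y * p)%g (toK i * q)%g.
have b2 := coch2_neq0 beta p (toK i * q)%g.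
have w := coc3_neq0 omega (sgval y) (sgval p) (sgval i * sgval q)%g.
rewrite (canRL (mulfK b2) E1) (canRL (mulfK w) E2); field.
by rewrite w b0 b1 b2.
Qed.

(** Right translation changes both [beta] factors of the denominator, hence two instances of
    [dbeta], linked by the common factor [beta (i * q) y]. *)
Lemma hom_scalar_mulr y p i q :
  beta (p * (toK i * q))%g y * hom_scalar p i (q * y)%g
  = hom_scalar p i q
    * ((omega (sgval p * sgval i)%g (sgval q) (sgval y))^-1 * beta q y).
Proof.
have /= E1 := dbeta (toK i) q y; have /= E2 := dbeta p (toK i * q)%g y.
rewrite /= sgval_toK in E1 E2.
have /= E3 := coc3P omega (sgval p) (sgval i) (sgval q) (sgval y).
rewrite /hom_scalar [(toK i * (q * y))%g]mulgA.
have b1 := coch2_neq0 beta (toK i) q.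
have b2 := coch2_neq0 beta p (toK i * q)%g.
have b3 := coch2_neq0 beta (toK i) (q * y)%g.
have b4 := coch2_neq0 beta p (toK i * q * y)%g.
have w1 := coc3_neq0 omega (sgval p * sgval i)%g (sgval q) (sgval y).
have w3 := coc3_neq0 omega (sgval p) (sgval i * sgval q)%g (sgval y).
(* The three identities are solved for [beta q y], [beta (p * (i * q)) y] and [omega p i (q * y)];
   after substitution only a field identity remains. *)
rewrite mulrC in E1; rewrite [RHS]mulrAC in E2; rewrite mulrC in E3.
rewrite (canRL (mulfK b3) E1) (canRL (mulfK w1) E3).
have -> : beta (p * (toK i * q))%g y = beta p (toK i * q * y)%g * beta (toK i * q)%g y
    / (omega (sgval p) (sgval i * sgval q)%g (sgval y) * beta p (toK i * q)%g).
  by rewrite E2; field; rewrite w3 b2.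
field.
by rewrite w1 w3 b1 b2 b3 b4.
Qed.

Lemma hecke_hom_mor phi : bimod_mor (hecke_hom phi).
Proof.
split.
- move=> g; apply: deltaA_ind => [|s t Hs Ht|a x].
  + by rewrite !linear0.
  + by rewrite !linearD /= Hs Ht.
  rewrite !linearZ /=; congr (_ *: _).
  have hx := homog_deltaA x.
  have hf : homog (sgval x) (hecke_hom phi (deltaA x)).
    rewrite /homog hecke_hom_delta !linear_sum; apply: eq_bigr => p _.
    rewrite !linear_sum; apply: eq_bigr => i _.
    rewrite !linear_sum; apply: eq_bigr => q _ /=.
    (* The surviving terms have [p * (i * q) = x], which is the degree of their basis vector. *)
    case: eqP => [<-|_]; last by rewrite mulr0 scale0r linear0.
    rewrite /= sgval_toK -(sgval_toL i) mulgA.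
    exact: homogZ (homog_hecke_delta p (toL i) q).
  rewrite [LHS](_ : _ = hecke_hom phi (gproj A g (deltaA x))) //.
  rewrite (gproj_homog _ hx) (gproj_homog _ hf).
  by case: ifP; rewrite ?linear0.
- apply/lfunP; apply: tens_ind => [|s t Hs Ht|u v]; first by rewrite !linear0.
    by rewrite !linearD /= Hs Ht.
  move: u; apply: deltaA_ind => [|s t Hs Ht|a y].
  + by rewrite tpure0l !linear0.
  + by rewrite tpureDl !linearD /= Hs Ht.
  move: v; apply: deltaA_ind => [|s t Hs Ht|b x].
  + by rewrite tpure0r !linear0.
  + by rewrite tpureDr !linearD /= Hs Ht.
  rewrite !(tpureZl, tpureZr, linearZ) /=; congr (_ *: (_ *: _)).
  rewrite [LHS]comp_lfunE [RHS]comp_lfunE tmapE id_lfunE.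
  rewrite [X in hecke_hom phi X]amul_delta linearZ /= !hecke_hom_delta.
  (* The left action sends the index [p] to [y * p]; reindexing the side of [y * x] this way matches
     the sums term by term. *)
  rewrite scaler_sumr (reindex_inj (mulgI y)) tpure_sumr linear_sum.
  apply: eq_bigr => p _ /=; rewrite scaler_sumr tpure_sumr linear_sum.
  apply: eq_bigr => i _ /=; rewrite scaler_sumr tpure_sumr linear_sum.
  apply: eq_bigr => q _ /=; rewrite [RHS](blactZ_delta _ y p (toL i) q) scalerA.
  congr (_ *: _); rewrite -mulgA (inj_eq (mulgI y)) sgval_toL.
  case: eqP => [<-|_]; last by rewrite !(mulr0, mul0r).
  rewrite !mulr1 mulrCA hom_scalar_mull; exact: mulrA.
apply/lfunP; apply: tens_ind => [|s t Hs Ht|u v]; first by rewrite !linear0.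
  by rewrite !linearD /= Hs Ht.
move: u; apply: deltaA_ind => [|s t Hs Ht|a x].
- by rewrite tpure0l !linear0.
- by rewrite tpureDl !linearD /= Hs Ht.
move: v; apply: deltaA_ind => [|s t Hs Ht|b y].
- by rewrite tpure0r !linear0.
- by rewrite tpureDr !linearD /= Hs Ht.
rewrite !(tpureZl, tpureZr, linearZ) /=; congr (_ *: (_ *: _)).
rewrite [LHS]comp_lfunE [RHS]comp_lfunE tmapE id_lfunE.
rewrite [X in hecke_hom phi X]amul_delta linearZ /= !hecke_hom_delta.
rewrite scaler_sumr tpure_suml linear_sum.
apply: eq_bigr => p _ /=; rewrite scaler_sumr tpure_suml linear_sum.
apply: eq_bigr => i _ /=; rewrite scaler_sumr tpure_suml linear_sum.
(* On the right it is the innermost index that is shifted, from [q] to [q * y]. *)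
rewrite (reindex_inj (mulIg y)).
apply: eq_bigr => q _ /=; rewrite [RHS](bractZ_delta _ y p (toL i) q) scalerA.
congr (_ *: _); rewrite !mulgA (inj_eq (mulIg y)) sgval_toL.
case: eqP => [<-|_]; last by rewrite !(mulr0, mul0r).
rewrite !mulr1 mulrCA -[(p * toK i * q)%g]mulgA hom_scalar_mulr; exact: mulrA.
Qed.

(** * Bimodule maps correspond to functions on the intersection *)

Lemma toL_inj : injective toL.
Proof. by move=> i j /(congr1 sgval); rewrite !sgval_toL => /val_inj. Qed.

Lemma hecke_coef_hom phi x p i q :
  hecke_coef p (toL i) q (hecke_hom phi (deltaA x))
  = ((phi i : k) * hom_scalar p i q) * (p * (toK i * q) == x)%g%:R.
Proof.
have E p' i' q' (a : k) : hecke_coef p (toL i) q (a *: hecke_delta p' (toL i') q')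
    = a * [&& p == p', i == i' & q == q']%:R.
  by rewrite linearZ /= hecke_coef_delta (inj_eq toL_inj).
rewrite hecke_hom_delta; transitivity (\sum_p' \sum_i' \sum_q'
    ((phi i' : k) * hom_scalar p' i' q') * (p' * (toK i' * q') == x)%g%:R
      * [&& p == p', i == i' & q == q']%:R : k).
  do 3!(rewrite linear_sum; apply: eq_bigr => ? _); exact: E.
rewrite (bigD1 p) //= [X in _ + X]big1 ?addr0; last first.
  move=> p' n; do 2!(rewrite big1 // => ? _).
  by rewrite [p == _]eq_sym (negPf n) mulr0.
rewrite (bigD1 i) //= [X in _ + X]big1 ?addr0; last first.
  move=> i' n; rewrite big1 // => q' _.
  by rewrite [i == _]eq_sym (negPf n) andbF mulr0.
rewrite (bigD1 q) //= [X in _ + X]big1 ?addr0; last first.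
  by move=> q' n; rewrite [q == _]eq_sym (negPf n) !andbF mulr0.
by rewrite !eqxx !mulr1.
Qed.

Lemma hom_scalar_neq0 p i q : hom_scalar p i q != 0.
Proof. by rewrite mulf_neq0 ?invr_eq0 ?mulf_neq0 ?coc3_neq0 ?coch2_neq0. Qed.

(** The coefficient at [(1, i, 1)] of the image of [deltaA (toK i)] is [phi i] times a nonzero
    scalar. *)
Lemma hecke_hom_inj : injective hecke_hom.
Proof.
move=> phi phi' E; apply/ffunP => i.
have := congr1 (fun f : 'Hom(_, _) => hecke_coef 1%g (toL i) 1%g (f (deltaA (toK i)))) E.
rewrite !hecke_coef_hom mul1g mulg1 eqxx !mulr1.
exact/mulIf/hom_scalar_neq0.
Qed.

Lemma hecke_hom_linear : linear hecke_hom.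
Proof.
move=> a phi phi'; apply/lfunP => v.
rewrite add_lfunE scale_lfunE !hecke_homE /hecke_hom_fun.
do 3!(rewrite scaler_sumr -big_split /=; apply: eq_bigr => ? _).
rewrite !ffunE scalerA -scalerDl; congr (_ *: _).
by rewrite !mulrDl; congr (_ + _); rewrite -!mulrA.
Qed.

(** Bilinearity over [A] pulls first [p] to the left and then [q] to the right out of the argument
    of [f], leaving the image of [deltaA (toK i)]. *)
Lemma bimod_mor_coef f x p i q : bimod_mor (f : 'Hom(bimod_unit A, F)) ->
  x = (p * (toK i * q))%g ->
  hecke_coef p (toL i) q (f (deltaA x))
  = hom_scalar p i q * hecke_coef 1%g (toL i) 1%g (f (deltaA (toK i))).
Proof.
case=> _ fl fr ->.
have fmull y z : beta y z *: f (deltaA (y * z)%g) = blact F (deltaA y \ox f (deltaA z)).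
  have /lfunP/(_ (deltaA y \ox deltaA z)) := fl.
  rewrite [in LHS]comp_lfunE [in RHS]comp_lfunE tmapE id_lfunE => <-.
  by rewrite -linearZ /= -amul_delta.
have fmulr y z : beta y z *: f (deltaA (y * z)%g) = bract F (f (deltaA y) \ox deltaA z).
  have /lfunP/(_ (deltaA y \ox deltaA z)) := fr.
  rewrite [in LHS]comp_lfunE [in RHS]comp_lfunE tmapE id_lfunE => <-.
  by rewrite -linearZ /= -amul_delta.
have b1 := coch2_neq0 beta (toK i) q.
have b2 := coch2_neq0 beta p (toK i * q)%g.
have E1 := congr1 (hecke_coef p (toL i) q) (fmull p (toK i * q)%g).
have E2 := congr1 (hecke_coef 1%g (toL i) q) (fmulr (toK i) q).
(* The coefficient at [(p, i, q)] is traced back to [(1, i, q)] by the left action, then to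
   [(1, i, 1)] by the right action. *)
have := hecke_coef_lact p 1%g (toL i) q (f (deltaA (toK i * q)%g)).
have := hecke_coef_ract q 1%g (toL i) 1%g (f (deltaA (toK i))).
rewrite mulg1 mul1g -E1 -E2 !linearZ /= mul1g sgval_toL.
(* Normalization removes every action scalar except [omega p i q]. *)
have [_ -> _] := coc3_norm omega (sgval i) (sgval q).
have [_ -> _] := coc3_norm omega (sgval p) (sgval i).
rewrite (coch2_norm beta q).1 (coch2_norm beta p).2 invr1 !mulr1 mul1r.
move=> E3 E4; rewrite /hom_scalar -E3.
apply: (mulfI b2); rewrite [LHS]E4 /GRing.scale /=; field.
by rewrite b1 b2.
Qed.

Lemma bimod_mor_hecke_hom f : bimod_mor (f : 'Hom(bimod_unit A, F)) ->
  f = hecke_hom [ffun i => hecke_coef 1%g (toL i) 1%g (f (deltaA (toK i)))].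
Proof.
move=> mf; have [gf _ _] := mf; set phi := finfun _.
have [gf' _ _] := hecke_hom_mor phi.
apply/lfunP; apply: deltaA_ind => [|s t Hs Ht|a x]; first by rewrite !linear0.
  by rewrite !linearD /= Hs Ht.
rewrite !linearZ /=; congr (_ *: _); apply: hecke_coef_inj => p l q.
have hx : @homog _ _ (bimod_unit A) (sgval x) (deltaA x) by exact: homog_deltaA.
(* Off the degree of [x] both coefficients vanish, since both maps are graded. *)
have [def_x|ne] := eqVneq (sgval p * sgval l * sgval q)%g (sgval x); last first.
  by rewrite !(hecke_coef_homog (graded_homog _ hx)).
(* In [p * l * q = x] all elements but [l] are known to lie in [K], so [l] does too. *)
have lK : sgval l \in K :&: L.
  rewrite inE (subgP l) andbT -(groupMl _ (subgP p)) -(groupMr _ (subgP q)).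
  by rewrite def_x subgP.
have -> : l = toL (subg (K :&: L)%G (sgval l)).
  by apply: val_inj; rewrite [RHS]sgval_toL subgK.
set i := subg _ _.
have xE : x = (p * (toK i * q))%g.
  by apply: val_inj; rewrite /= sgval_toK subgK // mulgA def_x.
rewrite (bimod_mor_coef mf xE) hecke_coef_hom -xE eqxx mulr1 ffunE.
exact: mulrC.
Qed.

(** * The dimension count *)

Lemma dim_bimod_Hom_hecke : \dim (bimod_Hom (bimod_unit A) F) = #|K :&: L|.
Proof.
pose H := GRing.isLinear.Build k {ffun I -> k^o} 'Hom(bimod_unit A, F) _
  hecke_hom hecke_hom_linear.
pose h : {linear {ffun I -> k^o} -> 'Hom(bimod_unit A, F)} := HB.pack hecke_hom H.
(* The Hom space is the image of an injective linear map, so it has the dimension of the function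
   space on the intersection. *)
have -> : bimod_Hom (bimod_unit A) F = limg (linfun h).
  apply/vspaceP => f; apply/idP/idP.
    move/bimod_HomP/bimod_mor_hecke_hom => ->.
    by apply/memv_imgP; eexists; [exact: memvf | rewrite lfunE].
  case/memv_imgP => phi _ ->; rewrite lfunE; apply/bimod_HomP.
  exact: hecke_hom_mor.
rewrite limg_dim_eq; last first.
  apply/eqP; rewrite capfv; apply/lker0P => x y; rewrite !lfunE.
  exact: hecke_hom_inj.
rewrite dimvf /dim /= muln1 card_sub.
exact: eq_card.
Qed.

End HeckeHom.

Theorem proposition6p8 (k : closedFieldType) (k_char0 : [pchar k]%R =i pred0)
    (G : finGroupType) (omega : cocycle3 k G) (K L : {group G})
    (beta : cochain2 k (subg_of K)) (psi : cochain2 k (subg_of L))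
    (dbeta : cobounds omega beta) (dpsi : cobounds omega psi) :
  \dim (bimod_Hom (bimod_unit (tga dbeta)) (hecke dbeta dpsi)) = #|K :&: L|
  /\ (connected (hecke dbeta dpsi) <-> #|K :&: L| = 1%N).
(* Connectedness unfolds to dimension 1, so the equivalence becomes trivial once the dimension is
   substituted. *)
Proof. by rewrite /connected dim_bimod_Hom_hecke. Qed.
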